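(* Consider the noise-free 2-leader selection problem in a perfect $M$-ary tree with root $r$, $M\ge4$, height $h\ge4$ and $n$ nodes. The optimal leaders $x,y$, whose lowest common ancestor is $r$, are such that $d_{xy}=1$ and $d_{xr}=0$, and the resulting coherence with $S=\{x,y\}$ is $$ R_{NF}(S)=\frac12\left(n+\frac1{M-1}\right)\log_M(nM-n+1)-\frac{n(M^2+M-1)}{2M(M-1)}+\frac1{2M}. $$
   Context: A perfect $M$-ary tree is a rooted tree in which all non-leaf nodes have exactly $M$ children and all leaves are on the same level; the root is at level $0$ and the leaves at level $h$ (the height), so $n=(M^{h+1}-1)/(M-1)$. All edge weights equal $1$, and $d_{uv}$ is the graph distance (number of edges) between $u$ and $v$. The leaders are labelled so that $x$ is on a level no greater than that of $y$. For a connected graph with Laplacian $L$ and nonempty leader set $S\subseteq V$, let $L_{ff}$ be the principal submatrix of $L$ indexed by $V\setminus S$. The coherence for noise-free leaders $S$ (total steady-state variance of the followers under $\dot x_f=-L_{ff}x_f+d_f$, with $d_f$ a vector of zero-mean unit-variance white noise processes) is $$R_{NF}(S)=\tfrac12\operatorname{tr}(L_{ff}^{-1}).$$ The noise-free 2-leader selection problem is to minimize $R_{NF}(S)$ over nonempty $S\subseteq V$ with $|S|\le2$. *)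

(* Defs.v *)
From HB Require Import structures.
From mathcomp Require Import all_boot all_order all_algebra.
From mathcomp Require Import reals exp.

Set Implicit Arguments.
Unset Strict Implicit.
Unset Printing Implicit Defensive.

Import Order.TTheory GRing.Theory Num.Theory.

Section Trees.
Variables (V : finType) (e : rel V).
Implicit Types r a v w x y : V.

(* Number of edges of a shortest walk from x to y; the value is #|V| when
   there is no walk. *)
Definition dist x y : nat :=
  \big[minn/#|V|]_(k < #|V| | [exists p : k.-tuple V,
                                 path e x p && (last x p == y)]) k.

(* In a simple graph the duplicate-free e-cycles of size at most 2 are the
   empty one and the traversals x, y, x of a single edge; they are not cycles
   in the graph-theoretic sense. *)
Definition is_tree : Prop :=
  [/\ symmetric e, irreflexive e, (forall x y, connect e x y)
    & forall c : seq V, ucycle e c -> (size c <= 2)%N].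

Definition level r v : nat := dist r v.

Definition children r v : {set V} :=
  [set w | e v w & level r w == (level r v).+1].

Definition perfect_tree (M h : nat) r : Prop :=
  [/\ is_tree,
      (forall v, children r v != set0 -> #|children r v| = M)
    & (forall v, children r v = set0 -> level r v = h)].

(* Every node is an ancestor of itself: a lies on the path from r to v. *)
Definition ancestor r a v : bool := level r v == (level r a + dist a v)%N.

Definition lowest_common_ancestor r x y a : Prop :=
  [/\ ancestor r a x, ancestor r a y
    & forall b, ancestor r b x -> ancestor r b y -> (level r b <= level r a)%N].

End Trees.

Local Open Scope ring_scope.

Section Coherence.
Variables (R : realType) (V : finType) (e : rel V).

(* Rows and columns are indexed by V through its enumeration. *)
Definition laplacian : 'M[R]_#|V| :=
  diag_mx (\row_i #|[set w | e (enum_val i) w]|%:R)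
  - \matrix_(i, j) (e (enum_val i) (enum_val j))%:R.

(* The principal submatrix L_ff indexed by the followers V \ S. *)
Definition follower_laplacian (S : {set V}) : 'M[R]_#|~: S| :=
  let f (i : 'I_#|~: S|) := enum_rank (enum_val i) in mxsub f f laplacian.

(* invmx is the genuine inverse here: the submatrix is invertible whenever the
   graph is connected and S is nonempty. *)
Definition coherence_NF (S : {set V}) : R :=
  2^-1 * \tr (invmx (follower_laplacian S)).

Definition feasible_leaders (S : {set V}) : bool :=
  (S != set0) && (#|S| <= 2)%N.

Definition optimal_leaders (S : {set V}) : Prop :=
  feasible_leaders S /\
  forall T : {set V}, feasible_leaders T -> coherence_NF S <= coherence_NF T.

End Coherence.

Definition logb (R : realType) (b x : R) : R := ln x / ln b.

(* Main.v *)
Require Import Defs.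
From HB Require Import structures.
From mathcomp Require Import all_boot all_order all_algebra.
From mathcomp Require Import reals exp.
From mathcomp Require Import zify ring lra.

Set Implicit Arguments.
Unset Strict Implicit.
Unset Printing Implicit Defensive.

Import Order.TTheory GRing.Theory Num.Theory.

(** On a tree the Laplacian of u |-> dist u v is 2 - deg u, corrected by -2 at
v, because exactly one neighbour of u is closer to v. Hence the Gromov product
(u|v)_x inverts the Laplacian grounded at x, and a Schur complement grounds y
as well. The trace of the inverse is therefore
<<
  sum over u of  dist x u - (u|y)_x ^ 2 / D,    D = dist x y.
>>
Here the Gromov product at a vertex is the depth of the lowest common ancestor
once the tree is rooted there, and it is written [meet].

Root the tree at r. Let k be the depth of the meet of x and y, and let x and y
lie i and j levels below that meet, so that D = i + j. For a vertex u let a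
and b be the number of edges below depth k that the root path of u shares with
those of x and y; one of them is 0, by the ultrametric inequality for [meet].
The resistance from u to the leaders becomes (lemma [resistance_split])
<<
  level u + (k - 2 min (meet u x, k))
    + (i j - (a^2 + 2 j a) - (b^2 + 2 i b)) / D.
>>
Write s for the number of vertices below a child of the root, so n = M s + 1.
- The term with k sums to at least k: at most s vertices meet x outside the
  root, and 2 s < n. It costs to move the two leaders away from the root.
- a^2 + 2 j a is a sum of 2 l + 1 + 2 j over the levels l < a, so summing it
  over u counts nested subtrees with these weights. The subtrees shrink by a
  factor M >= 4 per level, faster than the weights grow, and each of the i
  levels contributes at most (2 j + 1) s, all but the first strictly less
  ([layer_bound]). The two layer sums thus are at most (4 i j + i + j) s.
- Since n > 4 s, the term n i j more than pays for 4 i j s. What is left is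
  -(i + j) s / D = -s.
So no pair costs less than the sum of all levels minus s, and equality forces
k = 0, i j = 0 and i, j <= 1, that is, one leader at the root and the other at
a child of the root; such a pair attains the bound. A single leader is the
case x = y, where D = 0 and division by D yields 0, as it should. *)

(** * Distances in a tree *)

Section TreeDistance.
Variables (V : finType) (e : rel V).
Hypothesis treeV : is_tree e.
Implicit Types u v w x y z : V.

Local Notation d := (dist e).

Lemma tree_sym : symmetric e. Proof. by case: treeV. Qed.

Lemma tree_irr : irreflexive e. Proof. by case: treeV. Qed.

Lemma dist_le_path x p : path e x p -> (d x (last x p) <= size p)%N.
Proof.
move=> ep; have [lt_p|le_p] := ltnP (size p) #|V|; last first.
  by apply: leq_trans le_p; rewrite /dist -minEnat -leEnat; apply: bigmin_le_id.
rewrite /dist -minEnat -leEnat.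
apply: (@bigmin_inf _ _ _ _ (Ordinal lt_p)) => //.
by apply/existsP; exists (in_tuple p); rewrite ep /=.
Qed.

Lemma dist_pathP x y :
  exists p, [/\ path e x p, last x p = y & size p = d x y].
Proof.
have [_ _ conn _] := treeV.
have [p0 /shortenP[p ep Up _] lastp] := connectP (conn x y).
have lt_p : (size p < #|V|)%N.
  by have := max_card (mem (x :: p)); rewrite (card_uniqP Up).
pose P (k : 'I_#|V|) :=
  [exists q : k.-tuple V, path e x q && (last x q == y)].
have P0 : P (Ordinal lt_p).
  by apply/existsP; exists (in_tuple p); rewrite ep lastp eqxx.
have le_id (i : 'I_#|V|) : P i -> ((i : nat) <= #|V|)%O.
  by move=> _; rewrite leEnat ltnW.
have := @bigmin_eq_arg _ _ _ _ _ _ _ P0 le_id; rewrite minEnat => def_d.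
rewrite {1}/dist def_d; case: arg_minP => // k /existsP[q /andP[eq /eqP lq]] _.
by exists q; rewrite size_tuple.
Qed.

Lemma distxx x : d x x = 0%N.
Proof. by apply/eqP; rewrite -leqn0 (@dist_le_path x [::]). Qed.

Lemma dist_eq0 x y : (d x y == 0%N) = (x == y).
Proof.
apply/eqP/eqP => [|->]; last exact: distxx.
by have [[|z p] [_ <- <-]] := dist_pathP x y.
Qed.

Lemma dist_tri y x z : (d x z <= d x y + d y z)%N.
Proof.
have [p [ep lp <-]] := dist_pathP x y; have [q [eq lq <-]] := dist_pathP y z.
by rewrite -size_cat -lq -lp -last_cat dist_le_path // cat_path ep lp.
Qed.

Lemma dist_sym x y : d x y = d y x.
Proof.
wlog suff le_d : x y / (d x y <= d y x)%N.
  by apply/eqP; rewrite eqn_leq !le_d.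
have [p [ep lp <-]] := dist_pathP y x.
have := @dist_le_path (last y p) (rev (belast y p)).
rewrite rev_path (@eq_path _ _ e) => [|u v]; last exact: tree_sym.
rewrite ep size_rev size_belast -lp; case: (p) => [|v q] /(_ isT) //=.
by rewrite rev_cons last_rcons.
Qed.

Lemma dist_edge x y : e x y -> d x y = 1%N.
Proof.
move=> exy; apply/eqP; rewrite eqn_leq lt0n dist_eq0; apply/andP; split.
  by have := @dist_le_path x [:: y]; rewrite /= exy; apply.
by apply: contraTneq exy => ->; rewrite tree_irr.
Qed.

Lemma dist_edge_le x y v : e x y -> (d x v <= (d y v).+1)%N.
Proof. by move=> exy; rewrite -add1n -(dist_edge exy) dist_tri. Qed.

Lemma exists_closer u v : u != v -> exists2 w, e u w & d u v = (d w v).+1.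
Proof.
rewrite -dist_eq0; have [[|w p] [/= ep lp def_d]] := dist_pathP u v.
  by rewrite -def_d.
case/andP: ep => euw ep _; exists w => //.
have := dist_le_path ep; have := dist_edge_le v euw; rewrite lp; lia.
Qed.

(** The edges of the graph with the vertex u deleted. *)
Definition off u : rel V := [rel y z | [&& e y z, y != u & z != u]].

Lemma connect_off_sym u : connect_sym (off u).
Proof.
apply: sym_connect_sym => y z; rewrite /off /= tree_sym.
by case: (e z y) => //=; rewrite andbC.
Qed.

(** A closed walk through u that leaves and re-enters it by different edges
would contain a cycle. *)
Lemma off_neighbours u w w' : e u w -> e u w' -> connect (off u) w w' -> w = w'.
Proof.
move=> euw euw' /connectP[p0 /shortenP[p ep Up _] {p0} def_w'].
have [_ irr _ acyc] := treeV.
have u_w : u != w by apply: contraTneq euw => <-; rewrite irr.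
have [ep' u_p] : path e w p /\ u \notin p.
  elim: p (w) ep {Up def_w'} => //= z p IHp y.
  by case/andP=> /and3P[-> _ z_u] /IHp[-> ?]; rewrite inE eq_sym negb_or z_u.
have: (size (u :: w :: p) <= 2)%N.
  apply: acyc; apply/andP; split; last first.
    by rewrite /= in Up; rewrite /= inE negb_or u_w u_p Up.
  by rewrite /= rcons_path euw ep' -def_w' tree_sym.
by rewrite def_w'; case: (p).
Qed.

(** A geodesic from z to v stays strictly closer to v than its start, so it
misses any u that is at least as far. *)
Lemma off_geodesic u v z :
  z != u -> (d z v <= d u v)%N -> connect (off u) z v.
Proof.
have [k] := ubnP (d z v); elim: k z => // k IHk z lt_k z_u le_zu.
have [<-|/exists_closer[w ezw dz]] := eqVneq z v; first exact: connect0.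
have w_u : w != u by apply: contraTneq le_zu => <-; rewrite dz ltnn.
apply: connect_trans (connect1 _) (IHk w _ w_u _).
    by rewrite /off /= ezw z_u.
  by rewrite dz in lt_k.
by apply: leq_trans le_zu; rewrite dz.
Qed.

Lemma edge_neq u w : e u w -> w != u.
Proof. by apply: contraTneq => ->; rewrite tree_irr. Qed.

(** Both neighbours would reach v without passing through u. *)
Lemma closer_unique u v w w' : e u w -> e u w' ->
  (d w v <= d u v)%N -> (d w' v <= d u v)%N -> w = w'.
Proof.
move=> euw euw' le_w le_w'; apply: (off_neighbours euw euw').
apply: connect_trans (off_geodesic (edge_neq euw) le_w) _.
by rewrite connect_off_sym off_geodesic // edge_neq.
Qed.

(** The next vertex on the geodesic from u to v, and u itself when u = v. *)
Definition closer u v : V := odflt u [pick w | e u w && (d w v < d u v)%N].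

Lemma closerP u v : u != v -> e u (closer u v) /\ d u v = (d (closer u v) v).+1.
Proof.
move=> u_v; rewrite /closer; case: pickP => [w /andP[euw lt_w]|none] /=.
  by split=> //; have := dist_edge_le v euw; lia.
by have [w euw dw] := exists_closer u_v; have := none w; rewrite euw dw leqnn.
Qed.

Lemma closer_eq u v w : u != v -> e u w -> (d w v <= d u v)%N -> w = closer u v.
Proof.
move=> u_v euw le_w; have [euc dc] := closerP u_v.
by apply: closer_unique le_w _ => //; rewrite dc.
Qed.

Lemma dist_neighbour u v w : e u w ->
  w = closer u v /\ d u v = (d w v).+1 \/ d w v = (d u v).+1.
Proof.
move=> euw; have [uv|u_v] := eqVneq u v.
  by right; rewrite -uv distxx dist_edge // tree_sym.
have [le_w|lt_w] := leqP (d w v) (d u v).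
  left; have def_w := closer_eq u_v euw le_w.
  by split=> //; rewrite def_w; case: (closerP u_v).
right; apply/eqP; rewrite eqn_leq lt_w andbT.
by rewrite dist_edge_le // tree_sym.
Qed.

(** * Ancestors and meets in a rooted tree *)

Variable r : V.
Local Notation lev := (level e r).
Local Notation below := (ancestor e r).

Lemma level_dist u v : (lev u <= lev v + d v u)%N.
Proof. exact: dist_tri. Qed.

Lemma below_refl u : below u u.
Proof. by rewrite /ancestor distxx addn0. Qed.

Lemma below_root u : below r u.
Proof. by rewrite /ancestor /level distxx. Qed.

Lemma below_trans b a u : below a b -> below b u -> below a u.
Proof.
rewrite /ancestor => /eqP ab /eqP bu.
have := level_dist u a; have := dist_tri b a u; lia.
Qed.

Definition parent u := closer u r.

Lemma parentP u : u != r -> e u (parent u) /\ lev u = (lev (parent u)).+1.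
Proof. by move=> /closerP[eup]; rewrite ![d _ r]dist_sym. Qed.

Lemma parent_below u : u != r -> below (parent u) u.
Proof.
move=> /parentP[eup lu]; rewrite /ancestor lu dist_edge ?addn1 //.
by rewrite tree_sym.
Qed.

Lemma level_eq0 u : (lev u == 0%N) = (u == r).
Proof. by rewrite /level dist_eq0 eq_sym. Qed.

(** The walk from u up to the root meets only ancestors of u. *)
Lemma off_root x u : ~~ below x u -> connect (off x) u r.
Proof.
have [k] := ubnP (lev u); elim: k u => // k IHk u lt_k x_u.
have [->|u_r] := eqVneq u r; first exact: connect0.
have [eup lu] := parentP u_r.
have x_p : ~~ below x (parent u).
  by apply: contra x_u => /below_trans; apply; apply: parent_below.
have neq z : ~~ below x z -> z != x.
  by apply: contraNneq => ->; apply: below_refl.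
apply: connect_trans (connect1 _) (IHk _ _ x_p).
  by rewrite /off /= eup !neq.
by rewrite lu in lt_k.
Qed.

Lemma below_rootE x : below x r = (x == r).
Proof.
apply/idP/eqP => [|->]; last exact: below_refl.
by rewrite /ancestor {1}/level distxx eq_sym addn_eq0 level_eq0 => /andP[/eqP].
Qed.

(** Outside its own subtree, a vertex is left through its parent. *)
Lemma closer_parent x u : ~~ below x u -> closer x u = parent x.
Proof.
move=> x_u; have x_neq_u : x != u.
  by apply: contraNneq x_u => <-; apply: below_refl.
have x_r : x != r by apply: contraNneq x_u => ->; apply: below_root.
have [exc dc] := closerP x_neq_u; have [exp dp] := closerP x_r.
apply: (off_neighbours exc exp).
have off_c : connect (off x) (closer x u) u.
  by rewrite off_geodesic ?edge_neq // dc.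
have off_p : connect (off x) (parent x) r.
  by rewrite off_geodesic ?edge_neq // dp.
apply: connect_trans off_c _; apply: connect_trans (off_root x_u) _.
by rewrite connect_off_sym.
Qed.

(** Depth of the lowest common ancestor, i.e. the Gromov product at r. *)
Definition meet u v := (lev u + lev v - d u v)./2.

Lemma meet_sym u v : meet u v = meet v u.
Proof. by rewrite /meet addnC dist_sym. Qed.

(** Trees are bipartite, so the halving in [meet] is exact. *)
Lemma odd_dist u v : odd (d u v) = odd (lev u + lev v).
Proof.
have [k] := ubnP (lev u); elim: k u => // k IHk u lt_k.
have [->|u_r] := eqVneq u r; first by rewrite /level distxx.
have [eup lu] := parentP u_r; rewrite lu in lt_k.
have IH := IHk _ lt_k; rewrite lu addSn /= -IH.
by case: (dist_neighbour v eup) => [[_ ->]|->] //=; rewrite negbK.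
Qed.

Lemma dist_meet u v : (d u v + (meet u v).*2 = lev u + lev v)%N.
Proof.
have le_d : (d u v <= lev u + lev v)%N.
  by have := dist_tri r u v; rewrite [d u r]dist_sym.
have := odd_double_half (lev u + lev v - d u v); rewrite oddB // odd_dist addbb.
by rewrite add0n -/(meet u v) => ->; rewrite subnKC.
Qed.

Lemma meet_le u v : (meet u v <= lev v)%N.
Proof.
by have := dist_meet u v; have := level_dist u v; rewrite dist_sym; lia.
Qed.

Lemma below_parent a x : below a x -> a != x -> below a (parent x).
Proof.
move=> ax a_x; have x_a : ~~ below x a.
  apply: contra a_x; move: ax; rewrite /ancestor -dist_eq0 [d x a]dist_sym; lia.
have x_r : x != r.
  by apply: contraNneq a_x => xr; rewrite xr below_rootE in ax *.
have [_ lx] := parentP x_r; rewrite eq_sym in a_x; have [_] := closerP a_x.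
rewrite (closer_parent x_a); move: ax.
by rewrite /ancestor lx !(dist_sym a); lia.
Qed.

(** If u is not below a, the geodesic from x to u passes through a and then
climbs above a, which is too long for a common ancestor as deep as a. *)
Lemma below_meet a x u : below a x -> (lev a <= meet u x)%N = below a u.
Proof.
have [k] := ubnP (lev x); elim: k x => // k IHk x lt_k ax.
have := dist_meet u x.
have [->|a_x] := eqVneq a x.
  by rewrite /ancestor [d u x]dist_sym; have := level_dist u x; lia.
have [xu|x_u] := boolP (below x u).
  rewrite (below_trans ax xu); move: ax xu.
  by rewrite /ancestor [d u x]dist_sym; lia.
have x_r : x != r.
  by apply: contraNneq a_x => xr; rewrite xr below_rootE in ax *.
have x_neq_u : x != u by apply: contraNneq x_u => <-; apply: below_refl.
have [_ lx] := parentP x_r; rewrite lx in lt_k *.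
have [_] := closerP x_neq_u; rewrite (closer_parent x_u).
have := dist_meet u (parent x); rewrite -(IHk _ lt_k (below_parent ax a_x)).
rewrite !(dist_sym _ u); lia.
Qed.

Lemma ancestor_at_level t x :
  (t <= lev x)%N -> exists2 a, below a x & lev a = t.
Proof.
have [k] := ubnP (lev x); elim: k x => // k IHk x lt_k.
rewrite leq_eqVlt => /predU1P[->|lt_t]; first by exists x; rewrite ?below_refl.
have x_r : x != r by rewrite -level_eq0; apply: contraTneq lt_t => ->.
have [_ lx] := parentP x_r; rewrite lx in lt_k lt_t.
have [a ap <-] := IHk _ lt_k lt_t; exists a => //.
exact: below_trans ap (parent_below x_r).
Qed.

(** Two vertices that meet a third one at depth t share its ancestor there. *)
Lemma meet_ultra v u w : (minn (meet u v) (meet v w) <= meet u w)%N.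
Proof.
set t := minn _ _; have [|a av def_t] := @ancestor_at_level t v.
  by rewrite (leq_trans (geq_minl _ _)) ?meet_le.
have au : below a u by rewrite -(below_meet u av) def_t geq_minl.
by rewrite -def_t below_meet // -(below_meet w av) def_t meet_sym geq_minr.
Qed.

Lemma childP a w :
  reflect [/\ e a w, below a w & lev w = (lev a).+1] (w \in children e r a).
Proof.
rewrite inE; apply: (iffP andP) => [[eaw /eqP lw]|[eaw _ ->]] //.
by split=> //; rewrite /ancestor lw dist_edge // addn1.
Qed.

Lemma child_below a u w : w \in children e r a ->
  below w u = [&& below a u, a != u & closer a u == w].
Proof.
case/childP=> eaw aw lw; apply/idP/and3P => [wu|[au a_u /eqP<-]].
  have au := below_trans aw wu; split=> //.
    by apply: contraTneq wu => <-; rewrite /ancestor lw; lia.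
  apply/eqP/esym/closer_eq => //.
    by apply: contraTneq wu => <-; rewrite /ancestor lw; lia.
  by move: wu au; rewrite /ancestor lw; lia.
have [eac dc] := closerP a_u; move: au; rewrite /ancestor dc.
have := level_dist u (closer a u); have := level_dist (closer a u) a.
by rewrite dist_edge //; lia.
Qed.

Lemma closer_child a u : below a u -> a != u -> closer a u \in children e r a.
Proof.
move=> au a_u; have [eac dc] := closerP a_u; rewrite inE eac /=.
have := level_dist u (closer a u); have := level_dist (closer a u) a.
by move: au; rewrite /ancestor (dist_edge eac) dc; lia.
Qed.

(** Each proper descendant of a lies below the child of a in its direction. *)
Lemma sum_below (F : V -> nat) a :
  (\sum_(u | below a u) F u =
   F a + \sum_(w in children e r a) \sum_(u | below w u) F u)%N.
Proof.
rewrite (bigD1 a) ?below_refl //=; congr addn.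
rewrite (partition_big (closer a) (mem (children e r a))) /=.
  apply: eq_bigr => w cw; apply: eq_bigl => u.
  by rewrite (child_below _ cw) eq_sym andbA.
by move=> u /andP[au u_a]; rewrite closer_child // eq_sym.
Qed.

(** Divided by the distance of the two leaders, this is what they gain on the
side of x when they meet at depth k and the other one lies j levels deeper. *)
Definition layer_sum x k j :=
  (\sum_u ((meet u x - k) ^ 2 + 2 * j * (meet u x - k)))%N.

End TreeDistance.

(** * Subtree sizes in a perfect tree *)

Fixpoint perfect_size (M t : nat) : nat :=
  if t is t'.+1 then (M * perfect_size M t').+1 else 1.

(** Sum of the levels of all vertices of a perfect tree of height t. *)
Fixpoint perfect_depth (M t : nat) : nat :=
  if t is t'.+1 then M * (perfect_depth M t' + perfect_size M t') else 0.

Lemma perfect_size_gt0 M t : (0 < perfect_size M t)%N.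
Proof. by case: t. Qed.

Section PerfectTree.
Variables (V : finType) (e : rel V) (M h : nat) (r : V).
Hypothesis perfV : perfect_tree e M h r.
Implicit Types u v w x y z : V.

Let treeV : is_tree e. Proof. by case: perfV. Qed.

Local Notation lev := (level e r).
Local Notation below := (ancestor e r).
Local Notation m := (meet e r).

(** Induction from the leaves upwards: by [sum_below], a subtree is made of its
root and of the M subtrees one level deeper. *)
Lemma perfect_below v :
  [/\ (lev v <= h)%N,
      (\sum_(u | below v u) 1 = perfect_size M (h - lev v))%N
    & (\sum_(u | below v u) lev u
       = lev v * perfect_size M (h - lev v) + perfect_depth M (h - lev v))%N].
Proof.
have [_ full leaf] := perfV.
have lev_max u : (lev u <= #|V|)%N.
  by rewrite /level /dist -minEnat -leEnat bigmin_le_id.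
have [k] := ubnP (#|V| - lev v); elim: k v => // k IHk v lt_k.
have IH w : w \in children e r v ->
  [/\ (lev v < h)%N,
      (\sum_(u | below w u) 1 = perfect_size M (h - (lev v).+1))%N
    & (\sum_(u | below w u) lev u
       = (lev v).+1 * perfect_size M (h - (lev v).+1)
         + perfect_depth M (h - (lev v).+1))%N].
  case/(childP treeV) => _ _ lw; rewrite -lw; apply: IHk.
  by move: (lev_max w) lt_k; rewrite lw; lia.
rewrite !(sum_below treeV).
have [ch0|ch] := eqVneq (children e r v) set0.
  by rewrite leaf // ch0 !big_set0 subnn /= muln1.
have [w0 /IH[lt_h _ _]] := set0Pn _ ch.
rewrite (eq_bigr (fun=> perfect_size M (h - (lev v).+1)));
  last by move=> w /IH[].
rewrite [X in (_ + X)%N = _ * _ + _](eq_bigr (fun=>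
    ((lev v).+1 * perfect_size M (h - (lev v).+1)
     + perfect_depth M (h - (lev v).+1))%N)); last by move=> w /IH[].
rewrite !sum_nat_const full // (ltnW lt_h).
by rewrite -(subnSK lt_h) /=; split=> //; lia.
Qed.

Lemma level_le_height v : (lev v <= h)%N.
Proof. by case: (perfect_below v). Qed.

Lemma card_perfect : #|V| = perfect_size M h.
Proof.
have [_ + _] := perfect_below r; rewrite /level distxx // subn0 => <-.
by rewrite -sum1_card; apply: eq_bigl => u; rewrite below_root.
Qed.

Lemma sum_level : (\sum_u lev u = perfect_depth M h)%N.
Proof.
have [_ _] := perfect_below r.
rewrite [level e r r]distxx // subn0 mul0n add0n => <-.
by apply: eq_bigl => u; rewrite below_root.
Qed.

(** The vertices meeting x at depth t or more form one subtree. *)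
Lemma sum_meet_ge x t : (t <= lev x)%N ->
  (\sum_u (t <= m u x) = perfect_size M (h - t))%N.
Proof.
case/(ancestor_at_level treeV) => a ax <-; have [_ <- _] := perfect_below a.
rewrite [RHS]big_mkcond /=; apply: eq_bigr => u _.
by rewrite below_meet //; case: ifP.
Qed.

Lemma sum_meet_gt x t : (lev x < t)%N -> (\sum_u (t <= m u x) = 0)%N.
Proof.
move=> lt_t; apply: big1 => u _; apply/eqP; rewrite eqb0 -ltnNge.
exact: leq_ltn_trans (meet_le treeV _ _ _) lt_t.
Qed.

Lemma sum_meet_geS x t :
  (M * \sum_u (t.+1 <= m u x) <= \sum_u (t <= m u x))%N.
Proof.
have [lt_t|le_t] := ltnP t (lev x); last by rewrite sum_meet_gt ?muln0.
rewrite !sum_meet_ge ?(ltnW lt_t) //.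
have lt_h : (t < h)%N by apply: leq_trans lt_t (level_le_height x).
by rewrite -(subnSK lt_h) /= leqnSn.
Qed.

Hypotheses (M_gt3 : (3 < M)%N) (h_gt0 : (0 < h)%N).
Local Notation s := (perfect_size M h.-1).

Lemma card_perfectS : #|V| = (M * s).+1.
Proof. by rewrite card_perfect; case: h h_gt0. Qed.

Lemma sum_meet_gt0 x : (\sum_u (0 < m u x) <= s)%N.
Proof.
have [lx|lx] := posnP (lev x); last by rewrite sum_meet_ge ?subn1.
by rewrite sum_meet_gt ?lx.
Qed.

(** Going l levels down divides the size of a subtree by at least 4 ^ l,
hence by at least 3 l + 1. *)
Lemma sum_meet_linear x k l :
  ((3 * l).+1 * \sum_u (k + l < m u x) <= s)%N.
Proof.
elim: l => [|l IHl].
  rewrite muln0 mul1n addn0; apply: leq_trans (sum_meet_gt0 x).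
  by apply: leq_sum => u _; case: (ltnP k) => // /(leq_ltn_trans (leq0n k))->.
apply: leq_trans IHl; have := sum_meet_geS x (k + l).+1; rewrite addnS.
by move: M_gt3; nia.
Qed.

(** The square of the number a of levels that u shares with x below depth k is
a sum of a odd numbers, so the sum over u becomes a sum over the levels l of
2 l + 1 + 2 j times the size of a subtree. These sizes decay geometrically
while the weights grow linearly, so every level but the first stays strictly
below (2 j + 1) s; the predecessor on the left records that strictness. *)
Lemma layer_bound x k j :
  (layer_sum e r x k j + (lev x - k).-1
   <= (2 * j).+1 * (lev x - k) * s)%N.
Proof.
rewrite /layer_sum; set i := (lev x - k)%N.
have odd_sum a : (a <= i)%N ->
    (a ^ 2 + 2 * j * a = \sum_(l < i) (l < a) * (2 * l + 2 * j).+1)%N.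
  move=> le_a; rewrite -{1 2}(minn_idPl le_a).
  elim: (i) => [|n IHn]; first by rewrite big_ord0 minn0 muln0.
  by rewrite big_ord_recr /= -IHn; case: (ltnP n a) => /= ?; nia.
have -> : (i.-1 = \sum_(l < i) (0 < l))%N.
  by case: (i) => [|n]; rewrite ?big_ord0 // big_ord_recl /= sum1_card card_ord.
rewrite (eq_bigr
  (fun u => \sum_(l < i) (k + l < m u x) * (2 * l + 2 * j).+1)%N).
  rewrite exchange_big -big_split /=.
  have -> : ((2 * j).+1 * i * s = \sum_(l < i) (2 * j).+1 * s)%N.
    by rewrite sum_nat_const card_ord mulnAC mulnC.
  apply: leq_sum => l _; rewrite -big_distrl /=.
  have := sum_meet_linear x k l; have := perfect_size_gt0 M h.-1.
  set c := (\sum_u _)%N; case: (nat_of_ord l) => [|l']; first by nia.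
  nia.
move=> u _; rewrite odd_sum; first by apply: eq_bigr => l _; rewrite ltn_subRL.
by rewrite leq_sub2r // meet_le.
Qed.
End PerfectTree.

Local Open Scope ring_scope.

(** * Coherence of one or two leaders in a tree *)

Section Coherence.
Variables (R : realType) (V : finType) (e : rel V).
Implicit Types u v w x y z : V.

(** A Green function grounded on S is the inverse of the follower Laplacian, and
its diagonal may be summed over all vertices because it vanishes on S. *)
Lemma coherence_green (S : {set V}) (G : V -> V -> R) :
  (forall w v, w \in S -> G w v = 0) ->
  (forall u v, u \notin S -> v \notin S ->
     \sum_(w | e u w) (G u v - G w v) = (u == v)%:R) ->
  coherence_NF R e S = 2^-1 * \sum_u G u u.
Proof.
move=> G0 GE; rewrite /coherence_NF; congr (_ * _).
pose B : 'M[R]_#|~: S| := \matrix_(i, j) G (enum_val i) (enum_val j).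
have LB1 : follower_laplacian R e S *m B = 1%:M.
  apply/matrixP=> i j; rewrite !mxE.
  have := enum_valP i; have := enum_valP j; rewrite !inE => Sj Si.
  rewrite -(inj_eq enum_val_inj) -(GE _ _ Si Sj).
  set u := enum_val i; set v := enum_val j.
  pose F w := (#|[set z | e u z]|%:R * (u == w)%:R - (e u w)%:R) * G w v.
  transitivity (\sum_(k < #|~: S|) F (enum_val k)).
    apply: eq_bigr => k _; rewrite /F !mxE !enum_rankK.
    by rewrite (inj_eq enum_rank_inj) mulr_natr.
  rewrite -(big_enum_val F) /=.
  transitivity (\sum_w F w).
    rewrite [RHS](bigID (mem S)) /= [X in _ = X + _]big1 ?add0r.
      by apply: eq_bigl => w; rewrite inE.
    by move=> w Sw; rewrite /F G0 ?mulr0.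
  rewrite (eq_bigr _ (fun w _ => mulrBl _ _ _)) !sumrB.
  congr (_ - _); last first.
    by rewrite [RHS]big_mkcond; apply: eq_bigr => w _; case: (e u w);
      rewrite ?mul1r ?mul0r.
  rewrite (bigD1 u) //= big1 ?addr0 => [|w w_u]; last first.
    by rewrite eq_sym (negbTE w_u) mulr0 mul0r.
  rewrite eqxx mulr1 mulr_natl cardsE -sumr_const.
  by apply: eq_bigl.
have [uL _] := mulmx1_unit LB1.
have -> : invmx (follower_laplacian R e S) = B.
  by rewrite -[B]mul1mx -(mulVmx uL) -mulmxA LB1 mulmx1.
rewrite [RHS](bigID (mem S)) /= big1 ?add0r => [|u Su]; last exact: G0.
rewrite (eq_bigl (mem (~: S))) => [|u]; last by rewrite !inE.
by rewrite big_enum_val; apply: eq_bigr => i _; rewrite mxE.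
Qed.

Hypothesis treeV : is_tree e.
Local Notation d := (dist e).

(** Every neighbour of u contributes -1, except the one on the way to v, which
contributes 1. *)
Lemma laplacian_dist u v :
  \sum_(w | e u w) ((d u v)%:R - (d w v)%:R : R)
    = 2 * (u != v)%:R - #|[set w | e u w]|%:R.
Proof.
pose c w : R := 2 * ((w == closer e u v) && (u != v))%:R - 1.
rewrite (eq_bigr c) => [|w euw]; last first.
  rewrite /c; have [uv|u_v] := eqVneq u v.
    rewrite -uv andbF distxx (dist_edge treeV) ?mulr0 //.
    by rewrite (tree_sym treeV).
  have [euc dc] := closerP treeV u_v; rewrite andbT.
  have [<-|w_c] := eqVneq (closer e u v) w.
    by rewrite dc -addn1 natrD /=; ring.
  case: (dist_neighbour treeV v euw) => [[w_eq]|->].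
    by rewrite w_eq eqxx in w_c.
  by rewrite -addn1 natrD /=; ring.
rewrite sumrB; congr (_ - _); last by rewrite cardsE -sum1_card natr_sum.
rewrite -mulr_sumr; congr (_ * _); have [_|u_v] := eqVneq u v.
  by rewrite big1 // => w _; rewrite andbF.
have [euc _] := closerP treeV u_v.
rewrite (bigD1 (closer e u v)) //= eqxx big1 ?addr0 // => w /andP[_].
by rewrite andbT => /negbTE->.
Qed.

Lemma natr_meet x u v :
  (meet e x u v)%:R = ((d x u)%:R + (d x v)%:R - (d u v)%:R) / 2 :> R.
Proof.
have := congr1 (fun k => k%:R : R) (dist_meet treeV x u v).
by rewrite /level -muln2 !natrD natrM; lra.
Qed.

Lemma laplacian_meet x u v :
  \sum_(w | e u w) ((meet e x u v)%:R - (meet e x w v)%:R : R)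
    = (u == v)%:R - (u == x)%:R.
Proof.
pose t w z : R := (d u z)%:R - (d w z)%:R.
rewrite (eq_bigr (fun w => 2^-1 * (t w x - t w v))) => [|w _]; last first.
  by rewrite /t !natr_meet ![d x _](dist_sym treeV); field.
rewrite -mulr_sumr sumrB !laplacian_dist.
by case: eqP => _; case: eqP => _ /=; field.
Qed.

Lemma meetxx x u : meet e x u u = d x u.
Proof. by have := dist_meet treeV x u u; rewrite distxx // /level; lia. Qed.

Lemma meet_root x v : meet e x x v = 0%N.
Proof.
by apply/eqP; rewrite -leqn0 meet_sym // (leq_trans (meet_le treeV _ _ _)) //
  /level distxx.
Qed.

(** Grounding x alone gives the Gromov product based at x as inverse of the
Laplacian; a Schur complement then grounds y. The formula survives x = y,
where the correction and its denominator both vanish. *)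
Lemma coherence_pair x y :
  coherence_NF R e [set x; y] =
    2^-1 * \sum_u ((d x u)%:R - (meet e x u y)%:R ^+ 2 / (d x y)%:R).
Proof.
pose G u v : R := (meet e x u v)%:R
  - (meet e x u y)%:R * (meet e x v y)%:R / (d x y)%:R.
rewrite (@coherence_green _ G) => [|w v|u v].
- by congr (_ * _); apply: eq_bigr => u _; rewrite /G meetxx expr2.
- rewrite !inE /G; have [-> _|_ /= /eqP->] := eqVneq w x.
    by rewrite !meet_root !mul0r subr0.
  have [<-|xy] := eqVneq x y; first by rewrite !meet_root !mul0r subr0.
  rewrite meetxx meet_sym // mulrAC divff ?mul1r ?subrr //.
  by rewrite pnatr_eq0 dist_eq0.
rewrite !inE !negb_or => /andP[u_x u_y] _.
pose t w z : R := (meet e x u z)%:R - (meet e x w z)%:R.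
rewrite (eq_bigr (fun w => t w v - (meet e x v y)%:R / (d x y)%:R * t w y)).
  rewrite sumrB -mulr_sumr !laplacian_meet (negbTE u_x) (negbTE u_y).
  by rewrite !subr0 mulr0 subr0.
by move=> w _; rewrite /t /G; ring.
Qed.

End Coherence.

(** * The optimal pairs *)

Section Optimality.
Variables (R : realType) (V : finType) (e : rel V) (M h : nat) (r : V).
Hypothesis perfV : perfect_tree e M h r.
Implicit Types (u v w x y z : V) (T : {set V}).

Let treeV : is_tree e. Proof. by case: perfV. Qed.

Local Notation d := (dist e).
Local Notation lev := (level e r).
Local Notation m := (meet e r).
Local Notation n := #|V|.
Local Notation s := (perfect_size M h.-1).

(** Twice the coherence of the leaders x and y. *)
Definition pair_cost x y : R :=
  \sum_u ((d x u)%:R - (meet e x u y)%:R ^+ 2 / (d x y)%:R).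

Section PairCost.
Variables x y : V.
Local Notation k := (m x y).
Local Notation i := (lev x - m x y)%N.
Local Notation j := (lev y - m x y)%N.

Lemma dist_pair : d x y = (i + j)%N.
Proof.
have := dist_meet treeV r x y; have := meet_le treeV r x y.
by have := meet_le treeV r y x; rewrite meet_sym //; lia.
Qed.

(** The vertex u branches off the path from x to y on the side of x, on the side
of y, or at the top, so one of the two differences below is 0. *)
Lemma resistance_split u :
  (d x u)%:R - (meet e x u y)%:R ^+ 2 / (d x y)%:R
  = (lev u)%:R + (k%:R - 2 * (minn (m u x) k)%:R)
    + ((i * j)%:R - ((m u x - k) ^ 2 + 2 * j * (m u x - k))%:R
       - ((m u y - k) ^ 2 + 2 * i * (m u y - k))%:R) / (d x y)%:R :> R.
Proof.
have hG : (d u y + (meet e x u y).*2 = d x u + d x y)%N.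
  exact: dist_meet treeV x u y.
have := meet_ultra treeV r x u y; have := meet_ultra treeV r y u x.
have := meet_ultra treeV r u x y.
rewrite [m y x](meet_sym treeV) [m x u](meet_sym treeV).
have := dist_meet treeV r u x; have := dist_meet treeV r u y.
have := meet_le treeV r x y; have := meet_le treeV r y x.
rewrite [m y x](meet_sym treeV) [d u x](dist_sym treeV).
move: hG dist_pair.
set D := d x y; set p := meet e x u y; set mx := m u x; set my := m u y.
set K := m x y; set X := level e r x; set Y := level e r y.
move=> hG dD leX leY h1 h2 h3 h4 h5.
(* By the ultrametric inequalities the minima of mx and of my with K agree. *)
have [a_eq b_eq] : (mx = minn mx K + (mx - K) /\ my = minn mx K + (my - K))%N.
  lia.
have ab0 : ((mx - K) * (my - K) = 0)%N by apply/eqP; rewrite muln_eq0; lia.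
have d_eq : (d x u + (minn mx K).*2 + (mx - K).*2 = lev u + K + (X - K))%N.
  lia.
have a_le : (mx - K <= X - K)%N by lia.
have p_eq : (p + (mx - K) = (X - K) + (my - K))%N by lia.
move: ab0 d_eq p_eq dD a_le; clear.
move: (mx - K)%N (my - K)%N (X - K)%N (Y - K)%N (minn mx K) (d x u) (lev u).
move: p K D => p K D a b i j mu dx l.
move=> /(congr1 (fun k => k%:R : R)); rewrite natrM => ab0.
move=> /(congr1 (fun k => k%:R : R)); rewrite -!muln2 !natrD !natrM => d_eq.
move=> /(congr1 (fun k => k%:R : R)); rewrite !natrD => p_eq.
move=> D_eq a_le.
have -> : dx%:R = l%:R + K%:R + i%:R - mu%:R * 2 - a%:R * 2 :> R by lra.
have -> : p%:R ^+ 2 = i%:R ^+ 2 + a%:R ^+ 2 + b%:R ^+ 2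
                      + 2 * i%:R * b%:R - 2 * i%:R * a%:R :> R.
  have -> : p%:R = i%:R + b%:R - a%:R :> R by lra.
  transitivity (i%:R ^+ 2 + a%:R ^+ 2 + b%:R ^+ 2 + 2 * i%:R * b%:R
                - 2 * i%:R * a%:R - 2 * (a%:R * b%:R) : R); first ring.
  by rewrite ab0 mulr0 subr0.
(* For x = y the division by D = 0 yields 0 on both sides. *)
have [D0|D_neq0] := eqVneq D 0%N.
  have [i0 a0] : i = 0%N /\ a = 0%N by lia.
  by rewrite D0 i0 a0 invr0 !mulr0; ring.
have : D%:R != 0 :> R by rewrite pnatr_eq0.
by rewrite D_eq natrD => ij_neq0; field.
Qed.

Lemma pair_cost_split :
  pair_cost x y = (\sum_u lev u)%:R
    + (n%:R * k%:R - 2 * (\sum_u minn (m u x) k)%:R)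
    + (n%:R * (i * j)%:R - (layer_sum e r x k j)%:R
       - (layer_sum e r y k i)%:R) / (d x y)%:R :> R.
Proof.
rewrite /pair_cost /layer_sum (eq_bigr _ (fun u _ => resistance_split u)).
rewrite !natr_sum.
rewrite 2!big_split /= -mulr_suml !sumrB -mulr_sumr.
by rewrite !sumr_const cardT -cardE !mulr_natl.
Qed.

End PairCost.

Hypotheses (M_gt3 : (3 < M)%N) (h_gt0 : (0 < h)%N).

Section PairBound.
Variables x y : V.
Local Notation k := (m x y).
Local Notation i := (lev x - m x y)%N.
Local Notation j := (lev y - m x y)%N.

(** Only the s vertices below the same child of the root as x contribute. *)
Lemma sum_above_pair : (\sum_u minn (m u x) k <= k * s)%N.
Proof.
apply: leq_trans (leq_mul (leqnn k) (sum_meet_gt0 perfV x)).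
rewrite big_distrr /=; apply: leq_sum => u _.
by case: (m u x) => [|t]; rewrite ?min0n // muln1 geq_minr.
Qed.

(** The two layer sums are at most (4 i j + i + j) s, and n >= 4 s + 1 absorbs
the product term. *)
Lemma branch_bound :
  (i * j + i.-1 + j.-1 + layer_sum e r x k j + layer_sum e r y k i
   <= n * (i * j) + (i + j) * s)%N.
Proof.
have := layer_bound perfV M_gt3 h_gt0 x (m x y) j.
have := layer_bound perfV M_gt3 h_gt0 y (m x y) i.
rewrite (card_perfectS perfV h_gt0).
set A := layer_sum _ _ _ _ _; set B := layer_sum _ _ _ _ _ => hA hB.
have : (4 * s * (i * j) <= M * s * (i * j))%N by rewrite !leq_mul.
by move: hA hB; nia.
Qed.

Lemma pair_cost_ge :
  (\sum_u lev u)%:R + k%:R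
    + ((i * j + i.-1 + j.-1)%:R - (d x y)%:R * s%:R) / (d x y)%:R
  <= pair_cost x y.
Proof.
rewrite pair_cost_split; apply: lerD; [apply: lerD => //|].
  have: (k + 2 * \sum_u minn (m u x) k <= n * k)%N.
    have := sum_above_pair; rewrite (card_perfectS perfV h_gt0).
    by move: M_gt3; nia.
  by rewrite -(ler_nat R) natrD !natrM; lra.
apply: ler_wpM2r; first by rewrite invr_ge0.
have := branch_bound; rewrite -dist_pair -(ler_nat R).
by rewrite !(natrD, natrM); lra.
Qed.

Lemma pair_cost_lower : (\sum_u lev u)%:R - s%:R <= pair_cost x y.
Proof.
apply: le_trans pair_cost_ge; rewrite -addrA lerD2l.
have k_ge0 : 0 <= k%:R :> R by [].
have s_ge0 : 0 <= s%:R :> R by [].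
have [->|D_neq0] := eqVneq (d x y) 0%N; first by rewrite invr0 mulr0; lra.
have D_gt0 : 0 < (d x y)%:R :> R by rewrite ltr0n lt0n.
rewrite -lerBlDl ler_pdivlMr //.
set E := (i * j + i.-1 + j.-1)%N.
have E_ge0 : 0 <= E%:R :> R by [].
by nra.
Qed.

(** Equality makes k, i j, i.-1 and j.-1 vanish, while i + j does not. *)
Lemma pair_cost_lower_eq : (lev x <= lev y)%N ->
  pair_cost x y <= (\sum_u lev u)%:R - s%:R -> lev x = 0%N /\ lev y = 1%N.
Proof.
move=> le_xy /(le_trans pair_cost_ge); rewrite -addrA lerD2l.
have s_gt0 : 0 < s%:R :> R by rewrite ltr0n perfect_size_gt0.
have k_ge0 : 0 <= k%:R :> R by [].
have [->|D_neq0] := eqVneq (d x y) 0%N.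
  by rewrite invr0 mulr0 => ?; exfalso; lra.
have D_gt0 : 0 < (d x y)%:R :> R by rewrite ltr0n lt0n.
set E := (i * j + i.-1 + j.-1)%N; rewrite -lerBrDl ler_pdivrMr // => le_E.
have : k%:R * (d x y)%:R + E%:R <= 0 :> R by lra.
rewrite -natrM -natrD lern0 addn_eq0 muln_eq0 (negbTE D_neq0) orbF.
case/andP=> /eqP k0; rewrite /E !addn_eq0 muln_eq0; move: D_neq0.
by rewrite dist_pair k0; lia.
Qed.

Lemma pair_cost_root_child : lev x = 0%N -> lev y = 1%N ->
  pair_cost x y = (\sum_u lev u)%:R - s%:R.
Proof.
move=> lx ly; have k0 : k = 0%N.
  by apply/eqP; rewrite -leqn0 -lx (meet_sym treeV) meet_le.
have mx0 u : m u x = 0%N by apply/eqP; rewrite -leqn0 -lx meet_le.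
have mu0 : (\sum_u minn (m u x) k = 0)%N.
  by apply: big1 => u _; rewrite mx0 min0n.
have A0 : layer_sum e r x k j = 0%N.
  by apply: big1 => u _; rewrite mx0 sub0n muln0.
have B_s : layer_sum e r y k i = s.
  rewrite -subn1 -(sum_meet_ge perfV (x := y)) ?ly //; apply: eq_bigr => u _.
  have : (m u y <= 1)%N by rewrite -ly meet_le.
  by rewrite k0 subn0 lx !mul0n addn0; case: (m u y) => [|[]].
rewrite pair_cost_split mu0 A0 B_s dist_pair k0 lx ly mul0n mulr0 mulr0.
by rewrite !subr0 addr0 sub0r divr1.
Qed.
End PairBound.

Lemma coherence_pair_cost x y :
  coherence_NF R e [set x; y] = 2^-1 * pair_cost x y.
Proof. exact: coherence_pair. Qed.

Lemma feasible_pair T : feasible_leaders T ->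
  exists x y, T = [set x; y] /\ (lev x <= lev y)%N.
Proof.
case/andP=> /set0Pn[x Tx] cardT.
have [y ->] : exists y, T = [set x; y].
  have : (#|T :\ x| <= 1)%N by rewrite (cardsD1 x) Tx in cardT.
  move=> card_T'; rewrite -(setD1K Tx).
  have [->|/set0Pn[y T'y]] := eqVneq (T :\ x) set0.
    by exists x; rewrite setU0 setUid.
  exists y; congr (_ |: _); apply/eqP.
  by rewrite eq_sym eqEcard sub1set T'y cards1.
by case: (leqP (lev x) (lev y)) => [le|/ltnW le];
  [exists x, y | exists y, x; rewrite setUC].
Qed.

Lemma exists_root_child : exists c, lev c = 1%N.
Proof.
have [_ _ leaf] := perfV; have [ch0|/set0Pn[c]] := eqVneq (children e r r) set0.
  by have := leaf r ch0; rewrite /level distxx; move: h_gt0 => /[swap] <-.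
by case/(childP treeV) => _ _; rewrite {2}/level distxx; exists c.
Qed.

Lemma optimal_pair x y : (lev x <= lev y)%N ->
  optimal_leaders R e [set x; y] <-> lev x = 0%N /\ lev y = 1%N.
Proof.
move=> le_xy; split=> [[_ opt]|[lx ly]].
  have [c lc] := exists_root_child.
  have lr : lev r = 0%N by rewrite /level distxx.
  have /opt : feasible_leaders [set r; c].
    by rewrite /feasible_leaders cards2; apply/andP; split;
      [apply/set0Pn; exists r; rewrite set21 | case: eqP].
  rewrite !coherence_pair_cost (pair_cost_root_child lr lc).
  rewrite ler_pM2l ?invr_gt0 //.
  exact: pair_cost_lower_eq.
split=> [|T /feasible_pair[z [w [-> _]]]].
  by rewrite /feasible_leaders cards2; apply/andP; split;
    [apply/set0Pn; exists x; rewrite set21 | case: eqP].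
rewrite !coherence_pair_cost (pair_cost_root_child lx ly).
rewrite ler_pM2l ?invr_gt0 //.
exact: pair_cost_lower.
Qed.

Lemma natr_card : n%:R * (M%:R - 1) + 1 = M%:R ^+ h.+1 :> R.
Proof.
rewrite (card_perfect perfV); elim: (h) => [|t IHt].
  by rewrite mul1r subrK.
rewrite [RHS]exprS -IHt [perfect_size M t.+1]/= -addn1 natrD natrM; ring.
Qed.

(** Closed form of the sum of all levels, cleared of denominators. *)
Lemma natr_sum_level :
  (\sum_u lev u)%:R * (M%:R - 1) + M%:R * n%:R
    = h.+1%:R * (n%:R * (M%:R - 1) + 1) :> R.
Proof.
rewrite (card_perfect perfV) (sum_level perfV).
elim: (h) => [|t IHt]; first by rewrite /=; ring.
have -> : perfect_size M t.+1 = (M * perfect_size M t + 1)%N by rewrite addn1.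
rewrite [perfect_depth M t.+1]/= -[t.+2]addn1 !(natrD, natrM).
set N : R := (perfect_size M t)%:R in IHt *.
set D : R := (perfect_depth M t)%:R in IHt *.
(* Subtract M times the left-hand side of the induction hypothesis. *)
apply: (addIr (- (M%:R * (D * (M%:R - 1) + M%:R * N)))).
rewrite {2}IHt; ring.
Qed.

End Optimality.

Theorem theorem14 (R : realType) (V : finType) (e : rel V) (r : V) (M h : nat)
    (hM : (4 <= M)%N) (hh : (4 <= h)%N) (hT : perfect_tree e M h r)
    (x y : V) (hxy : (level e r x <= level e r y)%N) :
  let n : R := #|V|%:R in
  let m : R := M%:R in
  (optimal_leaders R e [set x; y] <->
     [/\ lowest_common_ancestor e r x y r, dist e x y = 1%N & dist e x r = 0%N])
  /\
  (optimal_leaders R e [set x; y] ->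
     coherence_NF R e [set x; y] =
       2^-1 * (n + 1 / (m - 1)) * logb m (n * m - n + 1)
       - n * (m ^+ 2 + m - 1) / (2 * m * (m - 1)) + 1 / (2 * m)).
Proof.
have treeV : is_tree e by case: hT.
have h_gt0 : (0 < h)%N by apply: leq_trans hh.
have optE := optimal_pair R hT hM h_gt0 hxy.
split; [rewrite optE; split=> [[/eqP]|[_ dxy /eqP]] | ].
- rewrite (level_eq0 treeV) => /eqP-> ly; split=> //; last exact: distxx.
  by split=> [||b]; rewrite ?below_root ?(below_rootE treeV) // => /eqP->.
- by rewrite (dist_eq0 treeV) => /eqP xr; move: dxy; rewrite xr /level distxx.
case/optE=> lx ly; rewrite (coherence_pair_cost R hT).
rewrite (pair_cost_root_child R hT lx ly).
set T : R := (\sum_u _)%:R.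
set n : R := #|V|%:R; set m : R := M%:R.
have m_gt1 : 1 < m by rewrite ltr1n; lia.
have lnm : ln m != 0 by rewrite gt_eqF // ln_gt0.
have -> : n * m - n + 1 = m ^+ h.+1.
  by rewrite -(natr_card R hT); ring.
rewrite /logb lnXn; last by lra.
rewrite -[ln m *+ _]mulr_natl mulfK //.
have := natr_sum_level R hT; rewrite -/T -/n -/m => T_eq.
have n_s : n = m * (perfect_size M h.-1)%:R + 1.
  by rewrite /n (card_perfectS hT h_gt0) -addn1 natrD natrM.
have m_neq0 : m != 0 by rewrite gt_eqF // (lt_trans ltr01).
have m1_neq0 : m - 1 != 0 by rewrite subr_eq0 gt_eqF.
have -> : (perfect_size M h.-1)%:R = (n - 1) / m.
  by rewrite n_s addrK mulrC mulKf.
have -> : T = (h.+1%:R * (n * (m - 1) + 1) - m * n) / (m - 1).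
  by rewrite -T_eq addrK mulfK.
by field; rewrite m_neq0.
Qed.
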